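(* Let $\ell\geq 2$ be an integer. (1) Let $G$ be a simple graph such that $\mathrm{C}(G;K_{\ell})\geq 2$. Then $\beta_\ell(G)=\mathrm{C}(G;K_{\ell})$. (2) Let $n\geq 2$. Then $\mathrm{d}(K_n)=\beta(K_n)=\mathrm{C}(K_n;K_{2})$.
   Context: A simple graph is an undirected graph without loops and without multiple edges. $K_n$ is the complete graph on $n$ vertices. A homomorphism $f:G\to H$ is a map $f:V(G)\to V(H)$ with $f(u)f(v)\in E(H)$ whenever $uv\in E(G)$. A subgraph of $G$ is a graph whose vertex and edge sets are subsets of $V(G)$, $E(G)$. The union $G_1\cup\cdots\cup G_k$ has vertex set $\bigcup_i V(G_i)$ and edge set $\bigcup_i E(G_i)$. The hom-complexity $\mathrm{C}(G;H)$ is the least positive integer $k$ such that there are subgraphs $G_1,\dots,G_k$ of $G$ with $G=G_1\cup\cdots\cup G_k$ and, for each $i$, a homomorphism $G_i\to H$; $\mathrm{C}(G;H)=\infty$ if no such $k$ exists. A simple graph is $\ell$-partite if its vertex set can be partitioned into $\ell$ disjoint nonempty subsets $V_1,\dots,V_\ell$ such that each edge connects vertices in two different parts. It is an $\ell$-clique (complete $\ell$-partite graph) if moreover, for some such partition, its edges are exactly all pairs $\{u,v\}$ with $u\in V_i$, $v\in V_j$, $i\neq j$; a $2$-clique is a biclique. A family $\{G_1,\dots,G_k\}$ of subgraphs of $G$ is an edge covering of $G$ if $E(G)=\bigcup_i E(G_i)$. The $\ell$-particity $\beta_\ell(G)$ is the least positive integer $k$ such that $G$ has an edge covering with $k$ elements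 $\{G_1,\dots,G_k\}$, each $G_i$ being $\ell$-partite ($\infty$ if no such $k$ exists); $\beta(G)=\beta_2(G)$. The bipartite dimension $\mathrm{d}(G)$ is the least positive integer $k$ such that $G$ has an edge covering with $k$ elements $\{G_1,\dots,G_k\}$, each $G_i$ being a biclique ($\infty$ if no such $k$ exists). *)

(* Defs.v *)
From mathcomp Require Import all_boot all_order.
From mathcomp Require Import boolp classical_sets.

Set Implicit Arguments.
Unset Strict Implicit.
Unset Printing Implicit Defensive.

Local Open Scope classical_set_scope.

(* Vertex types are arbitrary: graphs are not assumed to be finite. *)
Record sgraph := SGraph {
  vertex : Type;
  edge : vertex -> vertex -> Prop;
  edge_sym : forall u v, edge u v -> edge v u;
  edge_irrefl : forall u, ~ edge u u }.

Lemma complete_sym n (u v : 'I_n) : u <> v -> v <> u.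
Proof. by move=> uv vu; apply: uv. Qed.

Lemma complete_irrefl n (u : 'I_n) : ~ (u <> u).
Proof. by move=> /(_ erefl). Qed.

Definition complete (n : nat) : sgraph :=
  @SGraph 'I_n (fun u v => u <> v) (@complete_sym n) (@complete_irrefl n).

Definition is_hom (G H : sgraph) (f : vertex G -> vertex H) : Prop :=
  forall u v, edge u v -> edge (f u) (f v).

Record subgraph (G : sgraph) := Subgraph {
  sub_vertex : set (vertex G);
  sub_edge : vertex G -> vertex G -> Prop;
  sub_edge_sym : forall u v, sub_edge u v -> sub_edge v u;
  sub_edge_vertex : forall u v, sub_edge u v -> sub_vertex u;
  sub_edge_edge : forall u v, sub_edge u v -> edge u v }.

Section SubgraphAsGraph.
Variables (G : sgraph) (S : subgraph G).

Let svertex := {x : vertex G | sub_vertex S x}.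
Let sedge (u v : svertex) := sub_edge S (sval u) (sval v).

Let sedge_sym u v : sedge u v -> sedge v u.
Proof. exact: sub_edge_sym. Qed.

Let sedge_irrefl u : ~ sedge u u.
Proof. by move=> /sub_edge_edge; apply: edge_irrefl. Qed.

Definition sgraph_of_subgraph : sgraph := SGraph sedge_sym sedge_irrefl.
End SubgraphAsGraph.

Coercion sgraph_of_subgraph : subgraph >-> sgraph.

Definition edge_covering (G : sgraph) (k : nat) (F : 'I_k -> subgraph G) :=
  forall u v, edge u v <-> exists i, sub_edge (F i) u v.

(* G = F 0 `|` ... `|` F (k - 1): equality of vertex sets and of edge sets *)
Definition is_union (G : sgraph) (k : nat) (F : 'I_k -> subgraph G) :=
  \bigcup_i sub_vertex (F i) = [set: vertex G] /\ edge_covering F.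

(* classical_sets.partition requires pairwise disjoint nonempty parts. *)
Definition partite (l : nat) (G : sgraph) : Prop :=
  exists P : 'I_l -> set (vertex G),
    partition [set: 'I_l] P [set: vertex G] /\
    forall u v, edge u v -> exists i j, [/\ i <> j, P i u & P j v].

Definition clique (l : nat) (G : sgraph) : Prop :=
  exists P : 'I_l -> set (vertex G),
    partition [set: 'I_l] P [set: vertex G] /\
    forall u v, edge u v <-> exists i j, [/\ i <> j, P i u & P j v].

Definition biclique (G : sgraph) : Prop := clique 2 G.

Variant enat := Fin of nat | Infty.

Definition enat_le (x y : enat) : bool :=
  match x, y with
  | _, Infty => true
  | Infty, Fin _ => false
  | Fin m, Fin n => m <= n
  end.

(* The least positive k satisfying P, and Infty if there is none. *)
Definition least_pos (P : nat -> Prop) : enat :=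
  match pselect (exists k, (0 < k) && `[< P k >]) with
  | left exP => Fin (ex_minn exP)
  | right _ => Infty
  end.

Definition hom_complexity (G H : sgraph) : enat :=
  least_pos (fun k => exists F : 'I_k -> subgraph G,
    is_union F /\ forall i, exists f : vertex (F i) -> vertex H, is_hom f).

Definition particity (l : nat) (G : sgraph) : enat :=
  least_pos (fun k => exists F : 'I_k -> subgraph G,
    edge_covering F /\ forall i, partite l (F i)).

Definition bipartite_dimension (G : sgraph) : enat :=
  least_pos (fun k => exists F : 'I_k -> subgraph G,
    edge_covering F /\ forall i, biclique (F i)).

(* Main.v *)
Require Import Defs.
From mathcomp Require Import all_boot.
From mathcomp Require Import boolp classical_sets.

(**
All three invariants count vertex colourings: each is the least positive k for
which there are k maps c_i from V(G) to a set of l colours such that every edge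
is bichromatic for some c_i.  Isolated vertices may be added freely to the
members of a covering, so these can all be taken to have vertex set V(G).  The
only obstruction is that l-partite graphs need l nonempty parts; a colouring
that omits a colour while two vertices share one is repaired by giving the
omitted colour to one of these two.  This is always possible if G does not
embed in K_l, in particular if C(G; K_l) >= 2.  In K_n the bichromatic edges
of a colouring form a complete multipartite graph, whence the bicliques.
*)

Set Implicit Arguments.
Unset Strict Implicit.
Unset Printing Implicit Defensive.

Local Open Scope classical_set_scope.

Lemma eq_least_pos (P Q : nat -> Prop) :
  (forall k, 0 < k -> P k <-> Q k) -> least_pos P = least_pos Q.
Proof.
move=> PQ; rewrite /least_pos.
have E k : (0 < k) && `[< P k >] = (0 < k) && `[< Q k >].
  by case: (ltnP 0 k) => //= k0; apply: asbool_equiv_eq; apply: PQ.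
case: pselect => [exP|nP]; case: pselect => [exQ|nQ] //.
- by congr Fin; apply: eq_ex_minn.
- by case: nQ; case: exP => k Pk; exists k; rewrite -E.
- by case: nP; case: exQ => k Qk; exists k; rewrite E.
Qed.

Lemma enat_le_least_pos (P : nat -> Prop) k m :
  enat_le (Fin m) (least_pos P) -> 0 < k -> P k -> m <= k.
Proof.
rewrite /least_pos; case: pselect => [exP /= le_m k0 Pk | nP _ k0 Pk].
  apply: leq_trans le_m _; case: ex_minnP => j _; apply.
  by rewrite k0; apply/asboolP.
by case: nP; exists k; rewrite k0; apply/asboolP.
Qed.

(** Induction on the number of omitted colours. A map that is not onto is not injective, by
    hypothesis, so some colour class has two points; moving one of them to an omitted colour only
    splits that class. *)
Lemma surjective_refinement (T : Type) (J : finType) (f : T -> J) :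
    (forall g : T -> J, injective g -> forall j, exists x, g x = j) ->
  exists2 g : T -> J,
    (forall j, exists x, g x = j) & forall x y, g x = g y -> f x = f y.
Proof.
move=> inj_surj.
pose missed (g : T -> J) := [set j | ~~ `[< exists x, g x = j >]]%SET.
have [m] := ubnP #|missed f|; elim: m f => // m IH f lt_m.
have [f_surj|] := pselect (forall j, exists x, f x = j); first by exists f.
move=> f_nsurj; have /existsNP[j jNf] := f_nsurj.
have [x [y [fxy xNy]]] : exists x y, f x = f y /\ x <> y.
  apply: contrapT => f_ninj; apply: f_nsurj; apply: inj_surj => x y fxy.
  by apply: contrapT => xNy; apply: f_ninj; exists x, y.
pose f' z := if pselect (z = x) then j else f z.
have f'x : f' x = j by rewrite /f'; case: pselect.
have f'E z : z <> x -> f' z = f z by rewrite /f'; case: pselect.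
have [|g g_surj gf'] := IH f'.
  rewrite -ltnS; apply: leq_trans lt_m; rewrite ltnS; apply: proper_card.
  apply/properP; split.
    (* No colour is lost: the old colour of [x] is still taken at [y]. *)
    apply/fintype.subsetP => i; rewrite !inE; apply: contra => /asboolP[z fz].
    apply/asboolP; have [zx|zNx] := pselect (z = x); last by exists z; rewrite f'E.
    by exists y; rewrite f'E -?fxy -?zx // zx => yx; apply: xNy.
  by exists j; rewrite !inE; [apply/asboolP | rewrite negbK; apply/asboolP; exists x].
exists g => // z t /gf'.
(* As [f] omits [j], the class of [x] under [f'] is [x] alone, so [f'] merges nothing. *)
have [->|zNx] := pselect (z = x); have [->|tNx] := pselect (t = x) => //.
- by rewrite f'x f'E // => jt; case: jNf; exists t.
- by rewrite f'x f'E // => zj; case: jNf; exists z.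
- by rewrite !f'E.
Qed.

Lemma partition_fibers (T J : Type) (f : T -> J) :
  (forall j, exists x, f x = j) ->
  partition [set: J] (fun j => [set x | f x = j]) [set: T].
Proof.
move=> f_surj; split => [|i j _ _ [x [<- <-]]|j _] //.
- by apply/seteqP; split=> // x _; exists (f x).
- exact: f_surj.
Qed.

Section ColourCovering.
Variables (G : sgraph) (l : nat).

(** Equivalently, the tuples of the [c i x] form a proper colouring of [G] with l^k colours. *)
Definition colour_covering k :=
  exists c : 'I_k -> vertex G -> 'I_l,
    forall u v, edge u v -> exists i, c i u <> c i v.

Section Bichromatic.
Variable c : vertex G -> 'I_l.

Definition bichromatic_edge u v := edge u v /\ c u <> c v.

Lemma bichromatic_edge_sym u v : bichromatic_edge u v -> bichromatic_edge v u.
Proof. by move=> [/edge_sym uv cuv]; split=> // /esym. Qed.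

Definition bichromatic : subgraph G :=
  @Subgraph G [set: vertex G] bichromatic_edge bichromatic_edge_sym
    (fun _ _ _ => I) (fun _ _ => @proj1 _ _).

Lemma bichromatic_hom :
  is_hom (H := complete l) (fun x : vertex bichromatic => c (sval x)).
Proof. by move=> u v []. Qed.

Let c_surj_sub : (forall j, exists x, c x = j) ->
  forall j, exists x : vertex bichromatic, c (sval x) = j.
Proof. by move=> c_surj j; have [x cx] := c_surj j; exists (exist _ x I). Qed.

Lemma bichromatic_partite :
  (forall j, exists x, c x = j) -> partite l bichromatic.
Proof.
move=> /c_surj_sub/partition_fibers c_part; eexists; split; first exact: c_part.
by move=> u v [_ cuv]; exists (c (sval u)), (c (sval v)).
Qed.

Lemma bichromatic_clique :
    (forall j, exists x, c x = j) -> (forall u v : vertex G, u <> v -> edge u v) ->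
  clique l bichromatic.
Proof.
move=> /c_surj_sub/partition_fibers c_part G_complete.
eexists; split; first exact: c_part.
move=> u v; split=> [[_ cuv]|[i [j [iNj /= cu cv]]]].
  by exists (c (sval u)), (c (sval v)).
have cuv : c (sval u) <> c (sval v) by rewrite cu cv.
by split=> //; apply: G_complete => uv; apply: cuv; rewrite uv.
Qed.

End Bichromatic.

Lemma bichromatic_covering k (c : 'I_k -> vertex G -> 'I_l) :
    (forall u v, edge u v -> exists i, c i u <> c i v) ->
  edge_covering (fun i => bichromatic (c i)).
Proof.
move=> cP u v; split=> [uv|[i []] //].
by have [i ciuv] := cP u v uv; exists i.
Qed.

Lemma clique_partite (H : sgraph) : clique l H -> partite l H.
Proof. by move=> [P [Ppart PE]]; exists P; split=> // u v /PE. Qed.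

Lemma partite_hom (H : sgraph) :
  partite l H -> exists f : vertex H -> vertex (complete l), is_hom f.
Proof.
move=> [P [[Pcover Ptriv _] PE]].
have /choice[f fP] (x : vertex H) : exists i, P i x.
  by have : [set: vertex H] x by []; rewrite -Pcover => -[i _ Pix]; exists i.
exists f => u v /PE[i [j [iNj Piu Pjv]]] fuv; apply: iNj.
(* Disjointness of the parts forces the chosen index to be the one given by the edge. *)
have -> : i = f u by apply: Ptriv => //; exists u.
by rewrite fuv; apply: Ptriv => //; exists v.
Qed.

Hypothesis l_gt0 : 0 < l.

Lemma hom_colouring (S : subgraph G) (f : vertex S -> vertex (complete l)) :
    is_hom f ->
  exists c : vertex G -> 'I_l, forall u v, sub_edge S u v -> c u <> c v.
Proof.
move=> f_hom.
(* The default colour outside [S] is harmless, since both ends of an edge of [S] lie in [S]. *)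
pose c x := if pselect (sub_vertex S x) is left Sx then f (exist _ x Sx)
            else Ordinal l_gt0.
exists c => u v Suv; rewrite /c.
case: pselect => [Su|[]]; last exact: sub_edge_vertex Suv.
case: pselect => [Sv|[]]; last exact: sub_edge_vertex (sub_edge_sym Suv).
exact: (f_hom (exist _ u Su) (exist _ v Sv)).
Qed.

Lemma hom_colour_covering k (F : 'I_k -> subgraph G) :
    edge_covering F ->
    (forall i, exists f : vertex (F i) -> vertex (complete l), is_hom f) ->
  colour_covering k.
Proof.
move=> Fcover Fhom.
have /choice[c cP] i : exists c : vertex G -> 'I_l,
    forall u v, sub_edge (F i) u v -> c u <> c v.
  by have [f /hom_colouring] := Fhom i.
by exists c => u v /Fcover[i Fiuv]; exists i; apply: cP.
Qed.

Lemma hom_complexityE :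
  hom_complexity G (complete l) = least_pos colour_covering.
Proof.
apply: eq_least_pos => k k_gt0; split=> [[F [[_ Fcover]]]|[c cP]].
  exact: hom_colour_covering.
exists (fun i => bichromatic (c i)); split; last first.
  by move=> i; eexists; apply: bichromatic_hom.
split; last exact: bichromatic_covering.
(* Every member has full vertex set, so any index serves; an empty family would miss isolated
   vertices. *)
by apply/seteqP; split=> // x _; exists (Ordinal k_gt0).
Qed.

(** This says that [G] has at least [l] vertices, in a form that also suits infinite vertex
    types. *)
Hypothesis inj_surj : forall g : vertex G -> 'I_l,
  injective g -> forall j, exists x, g x = j.

(** A refinement separates every pair that the original colouring separates, so each edge stays
    covered. *)
Lemma surjective_colour_covering k :
    colour_covering k ->
  exists2 c : 'I_k -> vertex G -> 'I_l,
    (forall i j, exists x, c i x = j) &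
    forall u v, edge u v -> exists i, c i u <> c i v.
Proof.
move=> [c cP].
have /choice[d dP] i : exists d : vertex G -> 'I_l,
    (forall j, exists x, d x = j) /\ (forall x y, d x = d y -> c i x = c i y).
  by have [d] := surjective_refinement (c i) inj_surj; exists d.
exists d => [i|u v /cP[i ciuv]]; first exact: (dP i).1.
by exists i => /(dP i).2.
Qed.

Lemma particityE : particity l G = least_pos colour_covering.
Proof.
apply: eq_least_pos => k _; split=> [[F [Fcover Fpart]]|].
  by apply: hom_colour_covering Fcover _ => i; apply: partite_hom.
move=> /surjective_colour_covering[c c_surj cP].
exists (fun i => bichromatic (c i)); split; first exact: bichromatic_covering.
by move=> i; apply: bichromatic_partite.
Qed.

End ColourCovering.

Lemma bipartite_dimensionE (G : sgraph) :
    (forall g : vertex G -> 'I_2, injective g -> forall j, exists x, g x = j) ->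
    (forall u v : vertex G, u <> v -> edge u v) ->
  bipartite_dimension G = least_pos (colour_covering G 2).
Proof.
move=> inj_surj G_complete.
apply: eq_least_pos => k _; split=> [[F [Fcover Fcl]]|].
  apply: hom_colour_covering Fcover _ => // i.
  exact: partite_hom (clique_partite (Fcl i)).
move=> /(surjective_colour_covering inj_surj)[c c_surj cP].
exists (fun i => bichromatic (c i)); split; first exact: bichromatic_covering.
by move=> i; apply: bichromatic_clique.
Qed.

Theorem theorem4p9 (l : nat) (hl : 2 <= l) :
  (forall G : sgraph,
     enat_le (Fin 2) (hom_complexity G (complete l)) ->
     particity l G = hom_complexity G (complete l)) /\
  (forall n : nat, 2 <= n ->
     bipartite_dimension (complete n) = particity 2 (complete n) /\
     particity 2 (complete n) = hom_complexity (complete n) (complete 2)).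
Proof.
have l_gt0 : 0 < l by apply: leq_trans hl.
split=> [G|n n_ge2].
  rewrite hom_complexityE // => C_ge2; apply: particityE => // g g_inj.
  (* An injective [g] is a proper colouring, so it alone covers all edges; this contradicts C(G;
     K_l) >= 2. *)
  suff G_cover1 : colour_covering G l 1.
    by have := enat_le_least_pos C_ge2 (ltn0Sn 0) G_cover1.
  exists (fun=> g) => u v uv; exists ord0 => /g_inj uv_eq.
  by move: uv; rewrite uv_eq; apply: edge_irrefl.
have inj_surj (g : 'I_n -> 'I_2) : injective g -> forall j, exists x, g x = j.
  (* An injection of [n] >= 2 points into two colours is onto by counting. *)
  move=> g_inj j; have /codomP[x ->] : j \in codom g.
    by apply: inj_card_onto; rewrite ?card_ord.
  by exists x.
by rewrite hom_complexityE // particityE // bipartite_dimensionE.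
Qed.
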